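(* Let $m>1$ be an odd integer and write $m=\prod_{s=1}^r p_s^{a_s}$, where $p_1,\ldots,p_r$ are distinct (odd) primes and $a_1,\ldots,a_r$ are positive integers. Let $\sigma_m$ and $\tau_m$ be the permutations defined in the context. Then $$\operatorname{sign}(\sigma_m)=-1\iff r=1\ \text{and}\ p_1\equiv1\pmod 4.$$ Also, $\operatorname{sign}(\tau_m)=-1$ if and only if either ($r=1$ and ($p_1\equiv 1\pmod 8$ or $p_1\equiv 4a_1+3\pmod 8$)), or ($r=2$ and $p_1+p_2\equiv0\pmod 4$). In particular, when $m$ is an odd prime we have $$\operatorname{sign}(\sigma_m)=-\left(\frac{-1}m\right)\quad\text{and}\quad \operatorname{sign}(\tau_m)=-\left(\frac 2m\right).$$
   Context: $(\frac{\cdot}{m})$ is the Legendre symbol for $m$ an odd prime. $\operatorname{sign}$ denotes the sign of a permutation of a finite set ($+1$ if even, $-1$ if odd). For an odd integer $m>1$: $\sigma_m$ is the permutation of $\{k: 1\le k\le m-1,\ \gcd(k,m)=1\}$ sending $k$ to its inverse $\bar k$ modulo $m$, i.e. $\bar k\in\{1,\ldots,m-1\}$ and $k\bar k\equiv 1\pmod m$. $\tau_m$ is the permutation of $\{k: 1\le k\le (m-1)/2,\ \gcd(k,m)=1\}$ sending $k$ to the unique integer $k^*\in\{1,\ldots,(m-1)/2\}$ such that $kk^*$ is congruent to $1$ or $-1$ modulo $m$. *)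

(* Defs.v *)
From mathcomp Require Import all_boot all_order all_algebra all_fingroup.
From mathcomp Require Import zify.

Set Implicit Arguments.
Unset Strict Implicit.
Unset Printing Implicit Defensive.

Import GRing.Theory.

Local Open Scope ring_scope.

Definition perm_sign (T : finType) (s : {perm T}) : int := (-1) ^+ odd_perm s.

Definition legendre (a : int) (p : nat) : int :=
  if (p%:Z %| a)%Z then 0
  else if [exists x : 'I_p, ((x%:Z) ^+ 2 == a %[mod p%:Z])%Z] then 1
  else -1.

(* 'I_m is {0, ..., m - 1}, so these are the integers 1 <= k <= m - 1 coprime
   to m; below, m.-1./2 is (m - 1)/2 since m is odd in all uses. The lemmas
   on inverses hold for every m, so sigma and tau need no hypothesis on m. *)
Definition unit_residues (m : nat) : Type :=
  {k : 'I_m | (1 <= k)%N && coprime k m}.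

Definition half_unit_residues (m : nat) : Type :=
  {k : 'I_m | [&& (1 <= k)%N, (k <= m.-1./2)%N & coprime k m]}.

Definition inv_rel (m : nat) (k j : unit_residues m) : bool :=
  ((val k)%:Z * (val j)%:Z == 1 %[mod m%:Z])%Z.

Definition half_inv_rel (m : nat) (k j : half_unit_residues m) : bool :=
  ((val k)%:Z * (val j)%:Z == 1 %[mod m%:Z])%Z
  || ((val k)%:Z * (val j)%:Z == -1 %[mod m%:Z])%Z.

Lemma coprime_inverse (m k : nat) (gt1m : (1 < m)%N) (co_km : coprime k m) :
  exists j : nat, [/\ (1 <= j)%N, (j < m)%N, coprime j m
                    & (k%:Z * j%:Z == 1 %[mod m%:Z])%Z].
Proof.
have k_gt0 : (0 < k)%N.
  by case: k co_km => //; rewrite /coprime gcd0n => /eqP E; rewrite E in gt1m.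
case: (egcdnP m k_gt0) => u v def_u _; rewrite (eqP co_km) in def_u.
pose j := (u %% m)%N.
have ltjm : (j < m)%N by rewrite ltn_mod; lia.
have Ej : (k * j = 1 %[mod m])%N.
  by rewrite modnMmr mulnC def_u modnMDl.
have co_j : coprime j m.
  have : coprime (k * j) m by rewrite -coprime_modl Ej coprime_modl coprime1n.
  by rewrite coprimeMl => /andP[].
exists j; split=> //; last by rewrite -PoszM !modz_nat eqz_nat; apply/eqP.
case: (posnP j) => // j0; move: co_j; rewrite j0 /coprime gcd0n; lia.
Qed.

Lemma inv_rel_ex (m : nat) (k : unit_residues m) :
  exists j : unit_residues m, inv_rel k j.
Proof.
case: k => k Pk; have /andP[k1 co_km] := Pk.
have gt1m : (1 < m)%N by apply: leq_ltn_trans k1 (ltn_ord k).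
have [j [j1 ltjm co_jm Ej]] := coprime_inverse gt1m co_km.
have Pj : (1 <= Ordinal ltjm)%N && coprime (Ordinal ltjm) m by rewrite /= j1.
by exists (Sub (Ordinal ltjm) Pj).
Qed.

Lemma half_inv_rel_ex (m : nat) (k : half_unit_residues m) :
  exists j : half_unit_residues m, half_inv_rel k j.
Proof.
case: k => k Pk; have /and3P[k1 km co_km] := Pk.
have gt1m : (1 < m)%N by apply: leq_ltn_trans k1 (ltn_ord k).
have [j [j1 ltjm co_jm Ej]] := coprime_inverse gt1m co_km.
have [lejm|gtjm] := leqP j m.-1./2.
  have Pj : [&& (1 <= Ordinal ltjm)%N, (Ordinal ltjm <= m.-1./2)%N
                & coprime (Ordinal ltjm) m] by rewrite /= j1 lejm.
  by exists (Sub (Ordinal ltjm) Pj); rewrite /half_inv_rel /= Ej.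
have ltim : (m - j < m)%N by lia.
have jm2 : (m != j * 2)%N.
  apply/eqP => E.
  have jE : j = 1%N by move: co_jm; rewrite [in coprime _ _]E /coprime gcdnMr => /eqP.
  by move: k1 km; lia.
have Pi : [&& (1 <= Ordinal ltim)%N, (Ordinal ltim <= m.-1./2)%N
                & coprime (Ordinal ltim) m].
  apply/and3P; split=> /=; [lia | lia |].
  have Em : ((m - j) + j)%N = m by rewrite subnK // ltnW.
  have := gcdnDl (m - j) j; have := gcdnDr j (m - j).
  by rewrite Em /coprime [gcdn _ j]gcdnC => <- ->.
exists (Sub (Ordinal ltim) Pi); rewrite /half_inv_rel /=; apply/orP; right.
move: Ej; rewrite !eqz_mod_dvd => Ej.
rewrite -(subzn (ltnW ltjm)) mulrBr opprK.
have -> : k%:Z * m%:Z - k%:Z * j%:Z + 1 = k%:Z * m%:Z - (k%:Z * j%:Z - 1).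
  by rewrite opprB addrA addrAC.
by apply: rpredB => //; apply: dvdz_mull.
Qed.

Definition sigma_fun (m : nat) (k : unit_residues m) : unit_residues m :=
  xchoose (inv_rel_ex k).

Definition tau_fun (m : nat) (k : half_unit_residues m) : half_unit_residues m :=
  xchoose (half_inv_rel_ex k).

Lemma sigma_funP (m : nat) (k : unit_residues m) : inv_rel k (sigma_fun k).
Proof. exact: xchooseP. Qed.

Lemma tau_funP (m : nat) (k : half_unit_residues m) :
  half_inv_rel k (tau_fun k).
Proof. exact: xchooseP. Qed.

Lemma inv_rel_sym (m : nat) (k j : unit_residues m) : inv_rel k j = inv_rel j k.
Proof. by rewrite /inv_rel mulrC. Qed.

Lemma half_inv_rel_sym (m : nat) (k j : half_unit_residues m) :
  half_inv_rel k j = half_inv_rel j k.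
Proof. by rewrite /half_inv_rel mulrC. Qed.

Lemma inv_rel_uniq (m : nat) (k j1 j2 : unit_residues m) :
  inv_rel k j1 -> inv_rel k j2 -> j1 = j2.
Proof.
case: k j1 j2 => [k Pk] [j1 P1] [j2 P2]; rewrite /inv_rel /= => E1 E2.
apply/val_inj/val_inj => /=.
have [_ co_km] := andP Pk.
have : (k%:Z * j1%:Z == k%:Z * j2%:Z %[mod m%:Z])%Z by rewrite (eqP E1) (eqP E2).
rewrite eqz_mod_dvd -mulrBr Gauss_dvdzr; last by rewrite coprimezE coprime_sym.
rewrite -eqz_mod_dvd !modz_nat eqz_nat !modn_small; try exact: ltn_ord.
by move/eqP.
Qed.

Lemma half_inv_rel_uniq (m : nat) (k j1 j2 : half_unit_residues m) :
  half_inv_rel k j1 -> half_inv_rel k j2 -> j1 = j2.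
Proof.
case: k j1 j2 => [k Pk] [j1 P1] [j2 P2]; rewrite /half_inv_rel /= => E1 E2.
apply/val_inj/val_inj => /=.
have [_ _ co_km] := and3P Pk.
have [l1 h1 _] := and3P P1; have [l2 h2 _] := and3P P2.
have : (m%:Z %| k%:Z * (j1%:Z - j2%:Z))%Z || (m%:Z %| k%:Z * (j1%:Z + j2%:Z))%Z.
  move: E1 E2; rewrite !eqz_mod_dvd mulrBr mulrDr.
  set x := k%:Z * j1%:Z; set y := k%:Z * j2%:Z.
  move=> /orP[]/dvdzP[a Ea] /orP[]/dvdzP[b Eb]; apply/orP.
  - by left; apply/dvdzP; exists (a - b); lia.
  - by right; apply/dvdzP; exists (a + b); lia.
  - by right; apply/dvdzP; exists (a + b); lia.
  - by left; apply/dvdzP; exists (a - b); lia.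
rewrite !Gauss_dvdzr; try by rewrite coprimezE coprime_sym.
case/orP; last first.
  rewrite -PoszD dvdzE !absz_nat => m_dvd.
  have lem : (m <= j1 + j2)%N by apply: dvdn_leq m_dvd; rewrite addn_gt0 l1.
  by clear -lem h1 h2 l1; lia.
rewrite -eqz_mod_dvd !modz_nat eqz_nat !modn_small; try exact: ltn_ord.
by move/eqP.
Qed.

Lemma sigma_fun_inj (m : nat) : injective (@sigma_fun m).
Proof.
move=> k1 k2 E; apply: (@inv_rel_uniq m (sigma_fun k1)); rewrite inv_rel_sym.
  exact: sigma_funP.
by rewrite E; exact: sigma_funP.
Qed.

Lemma tau_fun_inj (m : nat) : injective (@tau_fun m).
Proof.
move=> k1 k2 E; apply: (@half_inv_rel_uniq m (tau_fun k1));
  rewrite half_inv_rel_sym.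
  exact: tau_funP.
by rewrite E; exact: tau_funP.
Qed.

Definition sigma (m : nat) : {perm unit_residues m} := perm (@sigma_fun_inj m).

Definition tau (m : nat) : {perm half_unit_residues m} := perm (@tau_fun_inj m).

(* Main.v *)
Require Import Defs.
From mathcomp Require Import all_boot all_order all_algebra all_fingroup finfield.
From mathcomp Require Import zify ring.

Set Implicit Arguments.
Unset Strict Implicit.
Unset Printing Implicit Defensive.

Import GRing.Theory.
Local Open Scope ring_scope.

(** A permutation equal to its inverse is a product of disjoint
    transpositions, one for each pair of points that it moves, so its sign is
    decided by the parity of half the number of moved points.  Both [sigma m]
    and [tau m] are such involutions, and everything reduces to counting: the
    domains have [totient m] and [totient m / 2] points; the fixed points of
    [sigma m] are the square roots of 1 modulo m; those of [tau m] are the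
    square roots of 1 or of -1, each pair k, m - k counted once.

    By the Chinese remainder theorem the number of square roots of a constant
    is multiplicative in m, and modulo an odd prime power a unit has no square
    root or exactly two, x and -x.  Hence 1 has 2^r roots and -1 has 2^r or
    none, depending on whether it is a square modulo every p_s^a_s.  That it
    is one exactly when p_s is 1 modulo 4 comes from [tau] again: modulo p^n
    its domain has [(p - 1) / 2 * p^(n - 1)] points and it has two fixed
    points or one, according to whether -1 is a square, and an involution
    preserves the parity of fixed points and of points
    ([minus_one_square_prime_power]).

    Write g_s for half the totient of p_s^a_s, h for the product of the g_s,
    and b for 1 or 0 according to whether all the g_s are even.  Then
    [sigma m] moves 2^r (h - 1) points and [tau m] moves
    2^(r-1) (h - 1 - b).  The signs follow by looking at these numbers modulo
    4: many primes contribute a large power of 2, which leaves only r = 1 for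
    [sigma] and r = 1, 2 for [tau].

    For m prime, the Legendre symbol of -1 is given by the same criterion, and
    that of 2 by the second supplement to quadratic reciprocity, obtained here
    from Euler's criterion ([euler_criterion]) and the evaluation of
    2^((p-1)/2) by Gauss's reordering of a product ([two_exp_half]). *)

(** * Signs of involutions *)

(** On the left each fixed point counts twice and each moved point once, so
    every orbit, of size 1 or 2, contributes exactly 2. *)
Lemma card_add_fix_involution (T : finType) (s : {perm T}) :
  involutive s ->
  (#|T| + #|[set x | s x == x]| = 2 * #|porbits s|)%N.
Proof.
move=> sK.
have porbitE x y : (x \in porbit s y) = (x == y) || (x == s y).
  apply/porbitP/orP => [[i ->]|[/eqP->|/eqP->]]; last 2 first.
  - by exists 0%N; rewrite expg0 perm1.
  - by exists 1%N; rewrite expg1.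
  elim: i => [|i IH]; first by left; rewrite expg0 perm1.
  rewrite expgSr permM.
  by case: IH => /eqP ->; [right | left; rewrite sK].
have -> : (#|T| + #|[set x | s x == x]| = \sum_(x : T) (1 + (s x == x)))%N.
  rewrite big_split /= sum1_card -sum1dep_card big_mkcond /=.
  by congr addn; apply: eq_bigr => x _; case: (s x == x).
rewrite (partition_big_imset (porbit s)) /= mulnC -sum_nat_const.
apply: eq_bigr => _ /imsetP[y _ ->].
rewrite (eq_bigl (fun x => (x == y) || (x == s y))); last first.
  by move=> x; rewrite /= eq_porbit_mem porbitE.
have [fix_y|mov_y] := eqVneq (s y) y.
  rewrite (eq_bigl (pred1 y)) ?big_pred1_eq ?fix_y ?eqxx // => x.
  by rewrite orbb.
rewrite (bigD1 y) /= ?eqxx // (big_pred1 (s y)); last first.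
  move=> x /=; have [->|] := eqVneq x y; rewrite ?andbT ?andbF //=.
  by rewrite eq_sym (negPf mov_y).
by rewrite sK (negPf mov_y) eq_sym (negPf mov_y).
Qed.

Lemma odd_card_involution (T : finType) (s : {perm T}) :
  involutive s -> odd #|T| = odd #|[set x | s x == x]|.
Proof. by move/card_add_fix_involution; lia. Qed.

Lemma odd_perm_involution (T : finType) (s : {perm T}) :
  involutive s ->
  odd_perm s = odd ((#|T| - #|[set x | s x == x]|)./2).
Proof.
move/card_add_fix_involution; have := max_card [set x | s x == x].
rewrite /odd_perm; lia.
Qed.

(** * Sums over residues and half residues *)

(** For m odd, the fixed-point free reflection k |-> m - k pairs the residues
    in [1, (m - 1) / 2] with those above. *)
Lemma big_nat_fold_half (R : Type) (idx : R) (op : Monoid.com_law idx)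
    (m : nat) (F : nat -> R) :
  odd m ->
  \big[op/idx]_(1 <= k < m) F k =
  \big[op/idx]_(1 <= k < m.-1./2.+1) op (F k) (F (m - k)%N).
Proof.
move=> m_odd; rewrite (@big_cat_nat _ _ _ m.-1./2.+1) /=; [|lia|lia].
rewrite big_split /=; congr (op _ _).
rewrite (big_addn 0 _ 1) (big_addn 0 _ m.-1./2.+1) /= big_nat_rev /=.
rewrite (_ : m - m.-1./2.+1 = m.-1./2.+1 - 1)%N; last by lia.
by apply: eq_big_nat => i /andP[_ lt_i]; congr F; lia.
Qed.

Lemma sum_half_residues (m : nat) (P : pred nat) :
  odd m -> P 0%N = false -> (forall k, (0 < k < m)%N -> P (m - k)%N = P k) ->
  (\sum_(0 <= k < m) P k = 2 * \sum_(0 <= k < m) ((k <= m.-1./2) && P k))%N.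
Proof.
move=> m_odd P0 symP.
have m_gt0 : (0 < m)%N by case: (m) m_odd.
rewrite [LHS]big_ltn // P0 add0n.
rewrite big_nat_fold_half //= [in RHS]big_ltn // P0 add0n big_distrr /=.
rewrite [RHS](@big_cat_nat _ _ _ m.-1./2.+1) /=; [|lia|lia].
rewrite [X in (_ = _ + X)%N]big1_seq ?addn0; last first.
  by move=> k; rewrite mem_index_iota; lia.
by apply: eq_big_nat => k lt_k; rewrite symP; lia.
Qed.

Lemma card_sub_ord (m : nat) (P Q : pred nat) :
  (#|[set k : {k : 'I_m | P k} | Q (val k)]|
   = \sum_(0 <= k < m) (P k && Q k))%N.
Proof.
rewrite -(card_imset _ val_inj) big_mkord -big_mkcond sum1dep_card.
apply: eq_card => k; rewrite inE; apply/imsetP/andP => [[x Qx ->]|[Pk Qk]].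
  by split; [exact: (valP x) | rewrite inE in Qx].
by exists (Sub k Pk); rewrite ?inE.
Qed.

(** * Counting square roots modulo m *)

Definition is_sqrt (c : int) (m k : nat) : bool :=
  (m%:Z %| k%:Z ^+ 2 - c)%Z.

Definition sqrt_count (c : int) (m : nat) : nat :=
  (\sum_(0 <= k < m) is_sqrt c m k)%N.

Lemma eq_mod_is_sqrt (c : int) (m k j : nat) :
  (k = j %[mod m])%N -> is_sqrt c m k = is_sqrt c m j.
Proof.
move=> Ekj; rewrite /is_sqrt -!eqz_mod_dvd -[in LHS]modzXm modz_nat Ekj.
by rewrite -modz_nat modzXm.
Qed.

(** A common factor of k and m would divide c = k^2 - (k^2 - c), which is
    coprime to m. *)
Lemma coprime_is_sqrt (c : int) (m k : nat) :
  coprimez c m%:Z -> is_sqrt c m k -> coprime k m.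
Proof.
move=> co_c /dvdzP[q E].
have : coprimez (k%:Z ^+ 2) m%:Z.
  by rewrite -(subrK c (k%:Z ^+ 2)) E /coprimez gcdzC gcdzMDl gcdzC.
by rewrite coprimez_pexpl // coprimezE.
Qed.

Lemma is_sqrtN (c : int) (m k : nat) :
  (k <= m)%N -> is_sqrt c m (m - k) = is_sqrt c m k.
Proof.
move=> le_km; rewrite /is_sqrt -subzn //.
apply/dvdzP/dvdzP => -[q E].
  by exists (q - (m%:Z - 2 * k%:Z)); rewrite mulrBl -E; ring.
by exists (q + (m%:Z - 2 * k%:Z)); rewrite mulrDl -E; ring.
Qed.

Lemma is_sqrt_mul (c : int) (u v k : nat) :
  coprime u v -> is_sqrt c (u * v) k = is_sqrt c u k && is_sqrt c v k.
Proof. by move=> co_uv; rewrite /is_sqrt PoszM Gauss_dvdz. Qed.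

(** Reduction modulo u and v is a bijection onto pairs of residues, under
    which k is a square root of c if and only if both components are. *)
Lemma sqrt_countM (c : int) (u v : nat) :
  coprime u v -> (sqrt_count c (u * v) = sqrt_count c u * sqrt_count c v)%N.
Proof.
move=> co_uv.
have [u0|u_gt0] := posnP u; first by rewrite /sqrt_count u0 mul0n !big_nil.
have [v0|v_gt0] := posnP v; first by rewrite /sqrt_count v0 muln0 !big_nil muln0.
pose crt (k : 'I_(u * v)) : 'I_u * 'I_v :=
  (Ordinal (ltn_pmod k u_gt0), Ordinal (ltn_pmod k v_gt0)).
have crt_bij : bijective crt.
  apply: inj_card_bij; last by rewrite card_prod !card_ord.
  move=> k j [/eqP Eu /eqP Ev]; apply: val_inj; apply/eqP => /=.
  by have := chinese_remainder co_uv k j; rewrite Eu Ev !modn_small.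
rewrite /sqrt_count !big_mkord big_distrlr pair_big /= (reindex crt) /=; last first.
  exact: onW_bij.
apply: eq_bigr => k _; rewrite is_sqrt_mul // mulnb.
by congr (nat_of_bool (_ && _)); apply: eq_mod_is_sqrt; rewrite modn_mod.
Qed.

(** Applied to the totient and to the numbers of square roots of 1 and -1. *)
Lemma multiplicative_prod_prime_powers
    (f : nat -> nat) (r : nat) (p a : nat -> nat) :
  f 1%N = 1%N ->
  (forall u v, coprime u v -> f (u * v) = f u * f v)%N ->
  (forall s, (1 <= s <= r)%N -> prime (p s)) ->
  (forall s t, (1 <= s <= r)%N -> (1 <= t <= r)%N -> p s = p t -> s = t) ->
  (f (\prod_(1 <= s < r.+1) p s ^ a s) = \prod_(1 <= s < r.+1) f (p s ^ a s))%N.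
Proof.
move=> f1 fM; elim: r => [|r IH] p_pr p_inj; first by rewrite !big_geq.
rewrite !(@big_nat_recr _ _ _ r.+1) //= fM ?IH //.
- by move=> s s_r; apply: p_pr; lia.
- by move=> s t s_r t_r; apply: p_inj; lia.
rewrite big_nat_cond; apply: (big_ind (fun x => coprime x _)).
- exact: coprime1n.
- by move=> x y co_x co_y; rewrite coprimeMl co_x.
move=> s /andP[s_r _]; apply: coprimeXl; apply: coprimeXr.
rewrite prime_coprime ?dvdn_prime2; try by apply: p_pr; lia.
by apply/eqP => E; have := p_inj s r.+1; lia.
Qed.

(** If x is a root and k another one, p^n divides (k - x) (k + x).  The prime
    p divides at most one of the two factors, since otherwise it would divide
    2 x; so p^n divides one of them, and k is x or -x. *)
Lemma sqrt_count_prime_power (c : int) (p n : nat) :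
  prime p -> odd p -> (0 < n)%N -> coprimez c p%:Z ->
  sqrt_count c (p ^ n)%N = (2 * [exists k : 'I_(p ^ n), is_sqrt c (p ^ n) k])%N.
Proof.
move=> p_pr p_odd n_gt0 co_c; set q := (p ^ n)%N.
have q_odd : odd q by rewrite oddX p_odd orbT.
have q_gt1 : (1 < q)%N by rewrite -(exp1n n) ltn_exp2r // prime_gt1.
rewrite /sqrt_count big_mkord.
case: existsP => [[x x2]|no_sqrt]; last first.
  by rewrite big1 ?muln0 // => k _; case Ek: is_sqrt => //; case: no_sqrt; exists k.
have co_cq : coprimez c q%:Z by rewrite coprimezE coprimeXr.
have co_x : coprime x q := coprime_is_sqrt co_cq x2.
have x_gt0 : (0 < x)%N.
  by case: (posnP x) co_x => // ->; rewrite /coprime gcd0n; lia.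
have x_lt : (x < q)%N := ltn_ord x.
have lt_qx : (q - x < q)%N by lia.
have sqrtE (k : 'I_q) : is_sqrt c q k = (k == x) || (k == Ordinal lt_qx).
  apply/idP/orP => [k2|[/eqP->|/eqP->]] //; last by rewrite /= is_sqrtN // ltnW.
  have dvd_prod : (q%:Z %| (k%:Z - x%:Z) * (k%:Z + x%:Z))%Z.
    move: k2 x2; rewrite /is_sqrt => /dvdzP[u Eu] /dvdzP[v Ev].
    by apply/dvdzP; exists (u - v); rewrite [RHS]mulrBl -Eu -Ev; ring.
  have co_2x : ~~ (p %| 2 * x)%N.
    rewrite -prime_coprime // coprimeMr coprimen2 p_odd /=.
    by rewrite coprime_sym -(coprime_pexpr x p n_gt0).
  have [p_dvd|co_add] := boolP (p%:Z %| k%:Z + x%:Z)%Z; last first.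
    left; rewrite -val_eqE /=.
    move: dvd_prod; rewrite Gauss_dvdzl; last first.
      by rewrite coprimezE coprimeXl // prime_coprime.
    by rewrite -eqz_mod_dvd !modz_nat eqz_nat !modn_small.
  right; rewrite -val_eqE /=.
  move: dvd_prod; rewrite Gauss_dvdzr; last first.
    rewrite coprimezE coprimeXl // prime_coprime //.
    apply: contra co_2x => p_dvd'; change (p%:Z %| (2 * x)%N%:Z)%Z.
    move/dvdzP: p_dvd => [u Eu]; move: p_dvd' => /(@dvdzP p%:Z)[v Ev].
    by apply/dvdzP; exists (u - v); lia.
  rewrite -PoszD dvdzE !absz_nat => /dvdnP[[|[|d]] Ed].
  - lia.
  - lia.
  - have := ltn_ord k; nia.
rewrite (eq_bigr (fun k => (k == x) + (k == Ordinal lt_qx))%N) => [|k _]; last first.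
  rewrite sqrtE; have [->|_] := eqVneq k x; last by [].
  rewrite -val_eqE /=; case: eqP => //; move: q_odd; lia.
by rewrite big_split /= -!big_mkcond /= !big_pred1_eq.
Qed.

(** * Sizes and fixed points of sigma and tau *)

Lemma card_unit_residues (m : nat) :
  (1 < m)%N -> #|{: unit_residues m}| = totient m.
Proof.
move=> m_gt1; rewrite totient_count_coprime -cardsT.
have -> : [set: unit_residues m]
        = [set k : unit_residues m | predT (val (val k))].
  by apply/setP=> k; rewrite !inE.
rewrite (card_sub_ord m (fun k => (1 <= k)%N && coprime k m) predT).
apply: eq_big_nat => k _; rewrite andbT coprime_sym.
by case: (posnP k) => // ->; rewrite /coprime gcdn0; case: eqP => //; lia.
Qed.

Lemma coprime_subl (m k : nat) : (k <= m)%N -> coprime (m - k) m = coprime k m.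
Proof.
move=> le_km; rewrite /coprime -[in RHS](subKn le_km).
by rewrite -{2}(subnK le_km) gcdnDl -{4}(subnK le_km) subKn // gcdnDr gcdnC.
Qed.

Lemma card_half_unit_residues (m : nat) :
  (1 < m)%N -> odd m -> (2 * #|{: half_unit_residues m}| = totient m)%N.
Proof.
move=> m_gt1 m_odd.
pose P k := (1 <= k)%N && coprime k m.
rewrite -card_unit_residues // -!cardsT.
have -> : [set: unit_residues m]
        = [set k : unit_residues m | predT (val (val k))].
  by apply/setP=> k; rewrite !inE.
have -> : [set: half_unit_residues m]
        = [set k : half_unit_residues m | predT (val (val k))].
  by apply/setP=> k; rewrite !inE.
rewrite (card_sub_ord m P predT).
rewrite (card_sub_ord m (fun k => [&& 1 <= k, k <= m.-1./2 & coprime k m])%N predT).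
rewrite (@sum_half_residues m (fun k => P k && true)) //.
  by congr muln; apply: eq_big_nat => k _; rewrite /P !andbT andbCA.
by move=> k lt_k; rewrite /P coprime_subl; [congr (_ && _ && _); lia | lia].
Qed.

Lemma sigmaK (m : nat) : involutive (sigma m).
Proof.
move=> k; rewrite !permE; apply: (@inv_rel_uniq m (sigma_fun k)).
  exact: sigma_funP.
by rewrite inv_rel_sym sigma_funP.
Qed.

Lemma tauK (m : nat) : involutive (tau m).
Proof.
move=> k; rewrite !permE; apply: (@half_inv_rel_uniq m (tau_fun k)).
  exact: tau_funP.
by rewrite half_inv_rel_sym tau_funP.
Qed.

Lemma sigma_fixE (m : nat) (k : unit_residues m) :
  (sigma m k == k) = is_sqrt 1 m (val (val k)).
Proof.
rewrite permE /is_sqrt expr2 -eqz_mod_dvd -/(inv_rel k k).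
apply/eqP/idP => [{2}<-|]; first exact: sigma_funP.
exact/inv_rel_uniq/sigma_funP.
Qed.

Lemma tau_fixE (m : nat) (k : half_unit_residues m) :
  (tau m k == k) = is_sqrt 1 m (val (val k)) || is_sqrt (-1) m (val (val k)).
Proof.
rewrite permE /is_sqrt expr2 -!eqz_mod_dvd -/(half_inv_rel k k).
apply/eqP/idP => [{2}<-|]; first exact: tau_funP.
exact/half_inv_rel_uniq/tau_funP.
Qed.

Lemma card_fix_sigma (m : nat) :
  (1 < m)%N -> #|[set k | sigma m k == k]| = sqrt_count 1 m.
Proof.
move=> m_gt1.
have -> : [set k | sigma m k == k]
        = [set k : unit_residues m | is_sqrt 1 m (val (val k))].
  by apply/setP=> k; rewrite !inE sigma_fixE.
rewrite (card_sub_ord m (fun k => (1 <= k)%N && coprime k m)).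
apply: eq_big_nat => k _; case k2: is_sqrt; rewrite ?andbF // andbT.
have co_k : coprime k m by apply: coprime_is_sqrt k2; rewrite coprimezE coprime1n.
rewrite co_k andbT; case: (posnP k) co_k => // ->; rewrite /coprime gcd0n; lia.
Qed.

Lemma card_fix_tau (m : nat) :
  (1 < m)%N -> odd m ->
  (2 * #|[set k | tau m k == k]| = sqrt_count 1 m + sqrt_count (-1) m)%N.
Proof.
move=> m_gt1 m_odd.
pose Q k := is_sqrt 1 m k || is_sqrt (-1) m k.
have Q_pos k : Q k -> (1 <= k)%N && coprime k m.
  move=> Qk; have co_k : coprime k m.
    by case/orP: Qk; apply: coprime_is_sqrt; rewrite coprimezE coprime1n.
  rewrite co_k andbT; case: (posnP k) co_k => // ->; rewrite /coprime gcd0n; lia.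
have -> : [set k | tau m k == k]
        = [set k : half_unit_residues m | Q (val (val k))].
  by apply/setP=> k; rewrite !inE tau_fixE.
rewrite (card_sub_ord m (fun k => [&& 1 <= k, k <= m.-1./2 & coprime k m])%N).
rewrite -big_split /= [in RHS](eq_bigr (fun k => nat_of_bool (Q k))) => [|k _]; last first.
  (* A common root of 1 and -1 would give m | 2. *)
  rewrite /Q; case k2: is_sqrt; case k2': is_sqrt => //.
  move: k2 k2' => /dvdzP[u Eu] /dvdzP[v Ev].
  have : (m%:Z %| 2%:Z)%Z by apply/dvdzP; exists (v - u); lia.
  by rewrite dvdzE /= => /dvdn_leq; lia.
rewrite (@sum_half_residues m Q) //; last 2 first.
- by apply/negP => /Q_pos.
- by move=> k lt_k; rewrite /Q !is_sqrtN //; lia.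
congr muln; apply: eq_big_nat => k _; case Qk: (Q k); rewrite ?andbF // !andbT.
by case/andP: (Q_pos k Qk) => -> ->; rewrite andbT.
Qed.

(** * The quadratic character of 2 *)

(** The nonzero squares are roots of X^n - 1 for n = (#|F| - 1) / 2, and there are
    at least n of them because squaring is at most two-to-one; a non-square
    root would be one root too many. *)
Lemma euler_criterion (F : finFieldType) (a : F) :
  odd #|F| -> a != 0 ->
  [exists x : F, x ^+ 2 == a] = (a ^+ (#|F|.-1)./2 == 1).
Proof.
move=> F_odd a_neq0; set n := (#|F|.-1)./2.
have F_gt1 : (1 < #|F|)%N := finNzRing_gt1 F.
have sqr_root (x : F) : x != 0 -> (x ^+ 2) ^+ n = 1.
  move=> x_neq0; rewrite -exprM; apply: (mulfI x_neq0); rewrite mulr1 -exprS.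
  by rewrite (_ : (2 * n).+1 = #|F|)%N ?expf_card // /n; lia.
apply/existsP/eqP => [[x /eqP x2]|a_root].
  by rewrite -x2 sqr_root //; apply: contraNneq a_neq0 => x0; rewrite -x2 x0 expr0n.
apply/existsP; have [//|no_sqrt] := boolP [exists x : F, x ^+ 2 == a].
pose nonzero : {set F} := [set~ 0].
pose squares := [set x ^+ 2 | x in nonzero].
have squares_ge : (n <= #|squares|)%N.
  have -> : n = (#|nonzero|)./2 by rewrite cardsC1.
  rewrite -sum1_card (partition_big_imset (fun x : F => x ^+ 2)) /= -/squares.
  (* The fiber of squaring above x^2 is contained in {x, -x}. *)
  suff : (\sum_(y in squares) \sum_(x in nonzero | x ^+ 2 == y) 1 <= #|squares| * 2)%N.
    by move/half_leq; rewrite muln2 doubleK.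
  rewrite -sum_nat_const; apply: leq_sum => _ /imsetP[x x_neq0 ->].
  rewrite sum1dep_card; apply: leq_trans (_ : #|[set x; - x]| <= 2)%N; last first.
    by rewrite cards2; case: (_ != _).
  by apply/subset_leq_card/subsetP => y; rewrite !inE eqf_sqr => /andP[].
have a_notin : a \notin squares.
  apply: contra no_sqrt => /imsetP[x _ ->]; apply/existsP; by exists x.
have n_gt0 : (0 < n)%N by rewrite /n; lia.
have poly_neq0 : 'X^n - 1 != 0 :> {poly F} by rewrite -size_poly_eq0 size_Xn_sub_1.
have all_roots : all (root ('X^n - 1)) (enum (a |: squares)).
  apply/allP => y; rewrite mem_enum in_setU1 rootE hornerD hornerXn hornerN hornerC.
  rewrite subr_eq0 => /predU1P[-> //|/imsetP[x x_neq0 ->]]; first by apply/eqP.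
  by rewrite sqr_root //; rewrite !inE in x_neq0.
have := max_poly_roots poly_neq0 all_roots (enum_uniq _).
by rewrite size_Xn_sub_1 // -cardE cardsU1 a_notin add1n ltnS ltnNge squares_ge.
Qed.

Lemma prod_even_nat (n : nat) :
  (\prod_(1 <= k < n.*2.+1 | ~~ odd k) k = 2 ^ n * n`!)%N.
Proof.
elim: n => [|n IH]; first by rewrite big_geq.
rewrite doubleS big_mkcond 2?big_nat_recr //= -big_mkcond IH odd_double /=.
by rewrite factS expnS; nia.
Qed.

(** An even number above n is 2 n + 1 - k for an odd k at most n. *)
Lemma prod_even_nat_folded (n : nat) :
  (\prod_(1 <= k < n.*2.+1 | ~~ odd k) k
   = \prod_(1 <= k < n.+1) (if odd k then n.*2.+1 - k else k))%N.
Proof.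
rewrite big_mkcond /= big_nat_fold_half /= ?odd_double //=.
have -> : n.*2.+1.-1./2 = n by lia.
apply: eq_big_nat => k le_k.
rewrite oddB /=; last by lia.
by rewrite odd_double; case: (odd k); rewrite /= ?mul1n ?muln1.
Qed.

Lemma prime_ndvd_fact (p n : nat) : prime p -> (n < p)%N -> ~~ (p %| n`!)%N.
Proof.
move=> p_pr; elim: n => [|n IH] lt_np;
  first by rewrite dvdn1; have := prime_gt1 p_pr; lia.
by rewrite factS Euclid_dvdM // negb_or gtnNdvd // IH // ltnW.
Qed.

(** With n = (p - 1) / 2, the product of the even residues is 2^n n! directly,
    and modulo p also the product of k or -k, for k at most n, according to
    whether k is even or odd.  The sign is the parity of the number of odd k at
    most n, which is (n + 1) / 2 rounded down. *)
Lemma two_exp_half (p : nat) :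
  prime p -> odd p -> (2%:R : 'F_p) ^+ p.-1./2 = (-1) ^+ p.-1./2.+1./2.
Proof.
move=> p_pr p_odd; set n := p.-1./2.
have def_p : p = n.*2.+1 by rewrite /n; lia.
have fact_neq0 : (n`!)%:R != 0 :> 'F_p.
  by rewrite -(dvdn_pcharf (pchar_Fp p_pr)) prime_ndvd_fact //; lia.
apply: (mulIf fact_neq0); rewrite -natrX -natrM -prod_even_nat.
rewrite prod_even_nat_folded -def_p.
have count_odd j : (\sum_(1 <= k < j.+1) odd k = j.+1./2)%N.
  by elim: j => [|j IH]; [rewrite big_geq | rewrite big_nat_recr //= IH; lia].
rewrite -count_odd fact_prod !natr_prod -prodrXr -big_split /=.
apply: eq_big_nat => k le_k; case: (odd k); rewrite ?mul1r // mulN1r.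
rewrite natrB ?(pcharf0 (pchar_Fp p_pr)) ?sub0r //; lia.
Qed.

Lemma exists_is_sqrt_Fp (p : nat) (c : int) :
  prime p ->
  [exists x : 'I_p, is_sqrt c p x] = [exists y : 'F_p, y ^+ 2 == c%:~R].
Proof.
move=> p_pr.
have is_sqrtE k : is_sqrt c p k = ((k%:R : 'F_p) ^+ 2 == c%:~R).
  by rewrite /is_sqrt (dvdz_pcharf (pchar_Fp p_pr)) rmorphB rmorphXn /= subr_eq0.
apply/existsP/existsP => [[x]|[y]].
  by rewrite is_sqrtE => x2; exists x%:R.
have lt_yp : (y < p)%N by rewrite -[X in (_ < X)%N](Fp_cast p_pr) ltn_ord.
by move=> y2; exists (Ordinal lt_yp); rewrite is_sqrtE /= natr_Zp.
Qed.

Lemma two_square_mod_prime (p : nat) :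
  prime p -> odd p ->
  [exists x : 'I_p, is_sqrt 2 p x] = ~~ odd p.-1./2.+1./2.
Proof.
move=> p_pr p_odd.
have two_neq0 : 2%:R != 0 :> 'F_p.
  rewrite -(dvdn_pcharf (pchar_Fp p_pr)); apply/negP => /dvdn_leq.
  by have := odd_prime_gt2 p_odd p_pr; lia.
rewrite exists_is_sqrt_Fp // euler_criterion ?card_Fp // two_exp_half // -signr_odd.
case: (odd _); rewrite ?eqxx //=; apply/negP => /eqP E; move/negP: two_neq0; apply.
by rewrite -[2%:R]/(1 + 1) -{1}E addNr.
Qed.

(** * Square roots of 1 and -1 modulo prime powers *)

Lemma totient_odd_prime_power (p n : nat) :
  prime p -> odd p -> (0 < n)%N ->
  (totient (p ^ n) = 2 * (p.-1./2 * p ^ n.-1))%N.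
Proof.
move=> p_pr p_odd n_gt0; rewrite totient_pfactor // mulnA.
by congr muln; have := prime_gt1 p_pr; lia.
Qed.

Lemma sqrt_count1_prime_power (p n : nat) :
  prime p -> odd p -> (0 < n)%N -> sqrt_count 1 (p ^ n) = 2%N.
Proof.
move=> p_pr p_odd n_gt0.
rewrite sqrt_count_prime_power ?coprimezE ?coprime1n //.
suff -> : [exists k : 'I_(p ^ n), is_sqrt 1 (p ^ n) k] by [].
have q_gt1 : (1 < p ^ n)%N by rewrite -(exp1n n) ltn_exp2r // prime_gt1.
by apply/existsP; exists (Ordinal q_gt1); rewrite /is_sqrt expr1n subrr dvdz0.
Qed.

(** [tau] at q = p^n has [(p - 1) / 2 * p^(n - 1)] points, and 1 + e fixed points
    where e is 1 or 0 according to whether -1 is a square.  An involution has as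
    many fixed points as points modulo 2, so e is 1 if and only if (p - 1) / 2
    is even. *)
Lemma minus_one_square_prime_power (p n : nat) :
  prime p -> odd p -> (0 < n)%N ->
  [exists k : 'I_(p ^ n), is_sqrt (-1) (p ^ n) k] = ~~ odd p.-1./2.
Proof.
move=> p_pr p_odd n_gt0; set q := (p ^ n)%N.
have q_odd : odd q by rewrite oddX p_odd orbT.
have q_gt1 : (1 < q)%N by rewrite -(exp1n n) ltn_exp2r // prime_gt1.
have := card_fix_tau q_gt1 q_odd; rewrite sqrt_count1_prime_power //.
rewrite sqrt_count_prime_power ?coprimezE ?coprime1n // -/q.
have := card_half_unit_residues q_gt1 q_odd; rewrite totient_odd_prime_power //.
have := odd_card_involution (@tauK q).
set b := [exists k, _]; set T := #|_|; set f := #|_|.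
have : odd (p.-1./2 * p ^ n.-1) = odd p.-1./2 by rewrite oddM oddX p_odd orbT andbT.
by move: (p.-1./2 * _)%N => g; case: b => /=; lia.
Qed.

(** * The signs in terms of the factorization *)

Lemma perm_signN1 (T : finType) (s : {perm T}) : perm_sign s = -1 <-> odd_perm s.
Proof. by rewrite /perm_sign; case: odd_perm. Qed.

Lemma modn4_exp_odd (p k : nat) :
  odd p -> (p ^ k %% 4 = if odd k then p %% 4 else 1)%N.
Proof.
move=> p_odd; elim: k => [|k IH] //.
rewrite expnS -modnMm IH /=; case: (odd k) => /=; last by rewrite muln1 modn_mod.
have : (p %% 4 = 1 \/ p %% 4 = 3)%N by lia.
by case=> ->.
Qed.

(** The criterion for r = 1: with g half the totient of p^n and e = 1 or 0 as g
    is even or odd, [tau] moves g - 1 - e points, and half of this is odd if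
    and only if g is 0 or 3 modulo 4.  For p = 3, 7 modulo 8 the condition
    depends on n because p^(n - 1) is then p or 1 modulo 4. *)
Lemma half_totient_mod4 (p n : nat) :
  odd p -> (0 < n)%N ->
  let g := (p.-1./2 * p ^ n.-1)%N in
  (g %% 4 = 0 \/ g %% 4 = 3)%N <->
  (p = 1 %[mod 8] \/ p = 4 * n + 3 %[mod 8])%N.
Proof.
move=> p_odd n_gt0; rewrite /= -modnMm modn4_exp_odd //.
have En : odd n.-1 = ~~ odd n by lia.
have E8 : (p %% 8 = 1 \/ p %% 8 = 3 \/ p %% 8 = 5 \/ p %% 8 = 7)%N by lia.
have E4 : (p %% 4 = p %% 8 %% 4)%N by lia.
have Eu : (p.-1./2 %% 4 = (p %% 8).-1./2)%N by lia.
have E3 : ((4 * n + 3) %% 8 = if odd n then 7 else 3)%N by case: ifP; lia.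
rewrite En Eu E4 E3; case: (odd n); case: E8 => [|[|[|]]] -> /=; clear;
  vm_compute; intuition discriminate.
Qed.

Section Factored.
Variables (m r : nat) (p a : nat -> nat).
Hypotheses (m_gt1 : (1 < m)%N) (m_odd : odd m).
Hypothesis p_prime : forall s : nat, (1 <= s <= r)%N -> prime (p s).
Hypothesis p_distinct : forall s t : nat, (1 <= s <= r)%N -> (1 <= t <= r)%N ->
       p s = p t -> s = t.
Hypothesis a_gt0 : forall s : nat, (1 <= s <= r)%N -> (0 < a s)%N.
Hypothesis m_fact : m = (\prod_(1 <= s < r.+1) p s ^ a s)%N.

Let half_totient (s : nat) : nat := ((p s).-1./2 * p s ^ (a s).-1)%N.
Let h : nat := (\prod_(1 <= s < r.+1) half_totient s)%N.
(** A product of booleans, hence 1 or 0: whether -1 is a square modulo m. *)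
Let b : nat := (\prod_(1 <= s < r.+1) ~~ odd (p s).-1./2)%N.

Lemma odd_prime_factor s : (1 <= s <= r)%N -> odd (p s).
Proof.
move=> s_r; have : (p s ^ a s %| m)%N.
  rewrite m_fact (big_rem s) ?mem_index_iota //=; exact: dvdn_mulr.
by move/(dvdn_odd)/(_ m_odd); rewrite oddX; have := a_gt0 s_r; case: (a s).
Qed.

Lemma prod_two_mul (F : nat -> nat) :
  (\prod_(1 <= s < r.+1) (2 * F s) = 2 ^ r * \prod_(1 <= s < r.+1) F s)%N.
Proof. by rewrite big_split /= prod_nat_const_nat subn1. Qed.

Lemma totient_factored : totient m = (2 ^ r * h)%N.
Proof.
rewrite m_fact multiplicative_prod_prime_powers //; last exact: totient_coprime.
rewrite -prod_two_mul; apply: eq_big_nat => s s_r.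
by rewrite totient_odd_prime_power ?p_prime ?odd_prime_factor ?a_gt0.
Qed.

Lemma sqrt_count_modulus1 c : sqrt_count c 1 = 1%N.
Proof. by rewrite /sqrt_count big_nat1 /is_sqrt dvd1z. Qed.

Lemma sqrt_count1_factored : sqrt_count 1 m = (2 ^ r)%N.
Proof.
rewrite m_fact multiplicative_prod_prime_powers ?sqrt_count_modulus1 //;
  last exact: sqrt_countM.
transitivity (\prod_(1 <= s < r.+1) 2)%N; last by rewrite prod_nat_const_nat subn1.
apply: eq_big_nat => s s_r.
by rewrite sqrt_count1_prime_power ?p_prime ?odd_prime_factor ?a_gt0.
Qed.

Lemma sqrt_countN1_factored : sqrt_count (-1) m = (2 ^ r * b)%N.
Proof.
rewrite m_fact multiplicative_prod_prime_powers ?sqrt_count_modulus1 //;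
  last exact: sqrt_countM.
rewrite -prod_two_mul; apply: eq_big_nat => s s_r.
rewrite sqrt_count_prime_power ?coprimezE ?coprime1n ?p_prime ?odd_prime_factor ?a_gt0 //.
by rewrite minus_one_square_prime_power ?p_prime ?odd_prime_factor ?a_gt0.
Qed.

Lemma odd_perm_sigma : odd_perm (sigma m) = odd ((2 ^ r * (h - 1))./2).
Proof.
rewrite (odd_perm_involution (@sigmaK m)).
rewrite card_unit_residues // card_fix_sigma // totient_factored sqrt_count1_factored.
by rewrite mulnBr muln1.
Qed.

Lemma odd_perm_tau : odd_perm (tau m) = odd ((2 ^ r * (h - (1 + b)))./2./2).
Proof.
rewrite (odd_perm_involution (@tauK m)).
have := card_half_unit_residues m_gt1 m_odd; have := card_fix_tau m_gt1 m_odd.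
rewrite totient_factored sqrt_count1_factored sqrt_countN1_factored => Ef Eh.
have -> : (2 ^ r * (h - (1 + b)) = 2 ^ r * h - (2 ^ r + 2 ^ r * b))%N.
  by rewrite mulnBr mulnDr muln1.
by rewrite -Ef -Eh -mulnBr mul2n doubleK.
Qed.

Lemma number_of_primes_gt0 : (0 < r)%N.
Proof. by rewrite lt0n; apply: contraTneq m_gt1 => r0; rewrite m_fact r0 big_geq. Qed.

Lemma half_totient_gt0 s : (1 <= s <= r)%N -> (0 < half_totient s)%N.
Proof.
move=> s_r; have p_gt1 := prime_gt1 (p_prime s_r); have := odd_prime_factor s_r => p_o.
by rewrite muln_gt0 expn_gt0; lia.
Qed.

Lemma odd_half_totient s :
  (1 <= s <= r)%N -> odd (half_totient s) = odd (p s).-1./2.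
Proof. by move=> s_r; rewrite oddM oddX odd_prime_factor // orbT andbT. Qed.

(** As h has the parity of the product of the (p_s - 1) / 2, the number
    2^(r - 1) (h - 1) is odd if and only if r = 1 and (p_1 - 1) / 2 is even. *)
Lemma perm_sign_sigma_iff :
  perm_sign (sigma m) = -1 <-> r = 1%N /\ (p 1%N = 1 %[mod 4])%N.
Proof.
rewrite perm_signN1 odd_perm_sigma; have := number_of_primes_gt0.
have [r1 _|r_neq1 r0] := eqVneq r 1%N; last first.
  have -> : r = r.-2.+2 by lia.
  by rewrite !expnS; split; lia.
have h1 : h = half_totient 1 by rewrite /h r1 big_nat1.
have r_1 : (1 <= 1 <= r)%N by rewrite r1.
have g_gt0 := half_totient_gt0 r_1; have g_odd := odd_half_totient r_1.
have p_o := odd_prime_factor r_1.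
rewrite h1 r1 expn1 mul2n doubleK; lia.
Qed.

(** The number to test is 2^(r - 2) (h - 1 - b).  It is even for r > 2.  For
    r = 2 it is h - 1 - b, where h is odd if and only if both (p_s - 1) / 2 are
    odd, and b is 1 if and only if both are even; so it is odd exactly when
    they have different parities.  For r = 1 see [half_totient_mod4]. *)
Lemma perm_sign_tau_iff :
  perm_sign (tau m) = -1 <->
        (r = 1%N /\ ((p 1 = 1 %[mod 8])%N \/ (p 1 = 4 * a 1 + 3 %[mod 8])%N))
        \/ (r = 2%N /\ (p 1 + p 2 = 0 %[mod 4])%N).
Proof.
rewrite perm_signN1 odd_perm_tau.
have r_cases : r = 1%N \/ r = 2%N \/ (2 < r)%N by have := number_of_primes_gt0; lia.
case: r_cases => [r1|[r2|r_ge3]]; last first.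
- have -> : r = r.-2.-1.+3 by lia.
  by rewrite !expnS; split; lia.
- have r_1 : (1 <= 1 <= r)%N by rewrite r2.
  have r_2 : (1 <= 2 <= r)%N by rewrite r2.
  have h2 : h = (half_totient 1 * half_totient 2)%N.
    by rewrite /h r2 big_nat_recr //= big_nat1.
  have b2 : b = (~~ odd (p 1%N).-1./2 * ~~ odd (p 2%N).-1./2)%N.
    by rewrite /b r2 big_nat_recr //= big_nat1.
  have h_gt0 : (0 < h)%N by rewrite h2 muln_gt0 !half_totient_gt0.
  have h_odd : odd h = odd (p 1%N).-1./2 && odd (p 2%N).-1./2.
    by rewrite h2 oddM !odd_half_totient.
  have := odd_prime_factor r_1; have := odd_prime_factor r_2; rewrite r2 b2.
  rewrite -[(2 ^ 2)%N]/4%N; clear -h_gt0 h_odd; move: h_odd.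
  case o1: (odd (p 1%N).-1./2); case o2: (odd (p 2%N).-1./2) => /=; lia.
have r_1 : (1 <= 1 <= r)%N by rewrite r1.
have := half_totient_mod4 (odd_prime_factor r_1) (a_gt0 r_1).
rewrite /= -/(half_totient 1).
have h1 : h = half_totient 1 by rewrite /h r1 big_nat1.
have b1 : b = ~~ odd (p 1%N).-1./2 by rewrite /b r1 big_nat1.
have g_gt0 := half_totient_gt0 r_1; have g_odd := odd_half_totient r_1.
move=> <-; rewrite h1 b1 r1 -g_odd expn1; clear -g_gt0.
by case o: (odd (half_totient 1)) => /=; lia.
Qed.

End Factored.

(** * The Legendre symbols of -1 and 2 *)

Lemma legendreE (c : int) (p : nat) :
  prime p -> coprimez c p%:Z ->
  legendre c p = if [exists x : 'I_p, is_sqrt c p x] then 1 else -1.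
Proof.
move=> p_pr co_c; rewrite /legendre ifN; last first.
  by rewrite dvdzE -prime_coprime // coprime_sym.
congr (if _ then _ else _); apply: eq_existsb => x.
by rewrite /is_sqrt -eqz_mod_dvd.
Qed.

Lemma legendreN1 (p : nat) :
  prime p -> odd p -> legendre (-1) p = if (p %% 4 == 1)%N then 1 else -1.
Proof.
move=> p_pr p_odd; rewrite legendreE ?coprimezE ?coprime1n //.
have /= := @minus_one_square_prime_power p 1 p_pr p_odd isT; rewrite expn1 => ->.
by congr (if _ then _ else _); lia.
Qed.

Lemma legendre2 (p : nat) :
  prime p -> odd p ->
  legendre 2 p = if ((p %% 8 == 1) || (p %% 8 == 7))%N then 1 else -1.
Proof.
move=> p_pr p_odd; rewrite legendreE ?two_square_mod_prime //; last first.
  by rewrite coprimezE coprime2n.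
by congr (if _ then _ else _); lia.
Qed.

Lemma perm_signE (T : finType) (s : {perm T}) (b : bool) :
  (perm_sign s = -1 <-> b) -> perm_sign s = - (if b then 1 else -1).
Proof.
rewrite perm_signN1 /perm_sign; case: odd_perm; case: b => -[] //.
  by move=> /(_ isT).
by move=> _ /(_ isT).
Qed.

Theorem theorem1p1 (m r : nat) (p a : nat -> nat)
    (m_gt1 : (1 < m)%N) (m_odd : odd m)
    (p_prime : forall s : nat, (1 <= s <= r)%N -> prime (p s))
    (p_distinct : forall s t : nat, (1 <= s <= r)%N -> (1 <= t <= r)%N ->
       p s = p t -> s = t)
    (a_gt0 : forall s : nat, (1 <= s <= r)%N -> (0 < a s)%N)
    (m_fact : m = (\prod_(1 <= s < r.+1) p s ^ a s)%N) :
  [/\ perm_sign (sigma m) = -1 <-> r = 1%N /\ (p 1%N = 1 %[mod 4])%N,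
      perm_sign (tau m) = -1 <->
        (r = 1%N /\ ((p 1 = 1 %[mod 8])%N \/ (p 1 = 4 * a 1 + 3 %[mod 8])%N))
        \/ (r = 2%N /\ (p 1 + p 2 = 0 %[mod 4])%N)
    & prime m ->
        perm_sign (sigma m) = - legendre (-1) m /\
        perm_sign (tau m) = - legendre 2 m].
Proof.
split; first exact: (perm_sign_sigma_iff m_gt1 m_odd p_prime p_distinct a_gt0 m_fact).
  exact: (perm_sign_tau_iff m_gt1 m_odd p_prime p_distinct a_gt0 m_fact).
move=> m_pr.
(* m itself is a factorization of m, with r = a_1 = 1. *)
have m_prime s : (1 <= s <= 1)%N -> prime ((fun=> m) s) by [].
have m_distinct s t : (1 <= s <= 1)%N -> (1 <= t <= 1)%N ->
    (fun=> m) s = (fun=> m) t -> s = t.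
  by move=> ? ? _; lia.
have m_exp s : (1 <= s <= 1)%N -> (0 < (fun=> 1) s)%N by [].
have m_fact1 : m = (\prod_(1 <= s < 2) (fun=> m) s ^ (fun=> 1%N) s)%N.
  by rewrite big_nat1 expn1.
have sigma_iff := perm_sign_sigma_iff m_gt1 m_odd m_prime m_distinct m_exp m_fact1.
have tau_iff := perm_sign_tau_iff m_gt1 m_odd m_prime m_distinct m_exp m_fact1.
rewrite legendreN1 // legendre2 //; split; apply: perm_signE.
  by rewrite sigma_iff; lia.
by rewrite tau_iff; lia.
Qed.
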